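(* Assume the density matrices $\rho_1,\dots,\rho_n$ are linearly independent over $\mathbb{R}$, i.e. there is no nonzero $c\in\mathbb{R}^n$ with $\sum_xc_x\rho_x=0$. Then for every $\lambda\ge0$ the function $p\mapsto\chi(p)-\lambda s^Tp$ is strictly concave on $\Delta_n$, and hence has a unique maximizer $p^*$ on $\Delta_n$ (in particular, for $\lambda=0$, the Holevo quantity $\chi$ has a unique maximizer on $\Delta_n$).
   Context: Density matrices $\rho_1,\dots,\rho_n\in\mathcal{D}^m$ ($m\times m$ complex positive semidefinite, trace one); $\Delta_n$ the probability simplex in $\mathbb{R}^n$; $s\in\mathbb{R}^n$, $s\ge0$. For $p\in\Delta_n$, $\rho_p=\sum_xp_x\rho_x$, $H(\rho)=-\operatorname{Tr}[\rho\ln\rho]$ (convention $0\ln0=0$), $\chi(p)=H(\rho_p)-\sum_xp_xH(\rho_x)$. *)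

(* Defs.v *)
From Stdlib Require Import Reals Lra ClassicalEpsilon.
Open Scope R_scope.

Record Cplx := mkC { re : R; im : R }.
Definition C0 : Cplx := mkC 0 0.
Definition C1 : Cplx := mkC 1 0.
Definition RtoC (r : R) : Cplx := mkC r 0.
Definition Cadd (a b : Cplx) : Cplx := mkC (re a + re b) (im a + im b).
Definition Cmul (a b : Cplx) : Cplx :=
  mkC (re a * re b - im a * im b) (re a * im b + im a * re b).
Definition Cconj (a : Cplx) : Cplx := mkC (re a) (- im a).

Fixpoint sumR (k : nat) (f : nat -> R) : R :=
  match k with O => 0 | S k' => sumR k' f + f k' end.
Fixpoint sumC (k : nat) (f : nat -> Cplx) : Cplx :=
  match k with O => C0 | S k' => Cadd (sumC k' f) (f k') end.

(** m x m complex matrices, entries indexed by i, j < m (others ignored). *)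
Definition Mat := nat -> nat -> Cplx.

Definition trace (m : nat) (A : Mat) : Cplx := sumC m (fun i => A i i).

Definition hermitian (m : nat) (A : Mat) : Prop :=
  forall i j, (i < m)%nat -> (j < m)%nat -> A i j = Cconj (A j i).

Definition qform (m : nat) (A : Mat) (v : nat -> Cplx) : Cplx :=
  sumC m (fun i => sumC m (fun j => Cmul (Cconj (v i)) (Cmul (A i j) (v j)))).

Definition psd (m : nat) (A : Mat) : Prop :=
  hermitian m A /\ forall v : nat -> Cplx, 0 <= re (qform m A v).

Definition density (m : nat) (A : Mat) : Prop :=
  psd m A /\ trace m A = C1.

Definition unitary (m : nat) (U : Mat) : Prop :=
  forall i j, (i < m)%nat -> (j < m)%nat ->
    sumC m (fun k => Cmul (Cconj (U k i)) (U k j)) = (if Nat.eqb i j then C1 else C0).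

Definition spectral_decomp (m : nat) (A : Mat) (U : Mat) (lam : nat -> R) : Prop :=
  unitary m U /\
  forall i j, (i < m)%nat -> (j < m)%nat ->
    A i j = sumC m (fun k => Cmul (U i k) (Cmul (RtoC (lam k)) (Cconj (U j k)))).

Definition eta (x : R) : R := if Rle_dec x 0 then 0 else x * ln x.

(** A chosen eigenvalue list of A (exists for Hermitian A by the spectral
    theorem; the entropy below does not depend on the choice). *)
Definition eigvals (m : nat) (A : Mat) : nat -> R :=
  epsilon (inhabits (fun _ => 0)) (fun lam => exists U, spectral_decomp m A U lam).

(** von Neumann entropy H(rho) = - Tr [rho ln rho] = - sum_k eta(lambda_k). *)
Definition vN_entropy (m : nat) (A : Mat) : R :=
  - sumR m (fun k => eta (eigvals m A k)).

Definition mixture (n : nat) (rho : nat -> Mat) (p : nat -> R) : Mat :=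
  fun i j => sumC n (fun x => Cmul (RtoC (p x)) (rho x i j)).

Definition holevo (m n : nat) (rho : nat -> Mat) (p : nat -> R) : R :=
  vN_entropy m (mixture n rho p) - sumR n (fun x => p x * vN_entropy m (rho x)).

Definition in_simplex (n : nat) (p : nat -> R) : Prop :=
  (forall x, (x < n)%nat -> 0 <= p x) /\ sumR n p = 1.

Definition dotR (n : nat) (s p : nat -> R) : R := sumR n (fun x => s x * p x).

Definition lin_indep (m n : nat) (rho : nat -> Mat) : Prop :=
  forall c : nat -> R,
    (forall i j, (i < m)%nat -> (j < m)%nat -> mixture n rho c i j = C0) ->
    forall x, (x < n)%nat -> c x = 0.

Definition strictly_concave_on_simplex (n : nat) (f : (nat -> R) -> R) : Prop :=
  forall p q, in_simplex n p -> in_simplex n q ->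
    (exists x, (x < n)%nat /\ p x <> q x) ->
    forall t, 0 < t < 1 ->
      t * f p + (1 - t) * f q < f (fun x => t * p x + (1 - t) * q x).

Definition unique_maximizer_on_simplex (n : nat) (f : (nat -> R) -> R) : Prop :=
  exists p, in_simplex n p /\
    (forall q, in_simplex n q -> f q <= f p) /\
    (forall q, in_simplex n q -> f p <= f q -> forall x, (x < n)%nat -> q x = p x).

(* Main.v *)
Require Import Defs.
From Stdlib Require Import Reals Lra Lia Classical ClassicalEpsilon.
From mathcomp Require all_boot all_order all_algebra spectral complex Rstruct.
Open Scope R_scope.

(** Let [eta x = x ln x] and let [d_k(A) = <u_k, A u_k>] be the diagonal of [A] in an
    orthonormal basis.  The [d_k(A)] are doubly stochastic averages of the eigenvalues of [A],
    so Jensen's inequality (Peierls) gives [sum_k g(d_k(A)) <= sum_k g(eigenvalue_k)] for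
    convex [g], with equality in an eigenbasis.

    Strict concavity: [eta x - x^2 / 4] is still convex on [0, 1], and the squares of the
    eigenvalues add up to the squared Frobenius norm.  In an eigenbasis of [t B + (1 - t) C]
    this yields
    [H(t B + (1 - t) C) >= t H(B) + (1 - t) H(C) + t (1 - t) / 4 * |B - C|^2],
    and linear independence makes [|rho_p - rho_q|] positive for [p <> q].

    Existence of a maximizer: for a fixed basis [H(A) <= - sum_k eta(d_k(A))], with equality
    at any prescribed [A] for a suitable basis, and [eta] is a supremum of affine functions.
    So the objective is an infimum of affine functions of [p], hence upper semicontinuous on
    the compact simplex. *)

(** * Unitary diagonalization, carried over from matrices over [R[i]] *)

Module ComplexMatrices.
Import all_boot all_order all_algebra spectral complex Rstruct.
Import Order.TTheory GRing.Theory Num.Theory Num.Def.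
Local Open Scope ring_scope.
Local Open Scope sesquilinear_scope.

Definition cpx (a : Cplx) : R[i] := Complex (Defs.re a) (Defs.im a).
Definition cmx (m : nat) (A : Mat) : 'M[R[i]]_m := \matrix_(i, j) cpx (A i j).

Lemma cpx_inj : injective cpx.
Proof. by case=> a b [c d] [-> ->]. Qed.

Lemma cpx_conj a : cpx (Cconj a) = conjC (cpx a).
Proof. by []. Qed.

Lemma cpx_sum m (f : nat -> Cplx) : cpx (sumC m f) = \sum_(i < m) cpx (f i).
Proof. by elim: m => [|m IH]; rewrite ?big_ord0 // big_ord_recr /= -IH. Qed.

Lemma sumRE m (f : nat -> R) : sumR m f = \sum_(i < m) f i.
Proof. by elim: m => [|m IH]; rewrite ?big_ord0 // big_ord_recr /= -IH. Qed.

Lemma ReE (a : Cplx) : Defs.re a = complex.Re (cpx a).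
Proof. by []. Qed.

Lemma Re_sum m (f : 'I_m -> R[i]) :
  complex.Re (\sum_(i < m) f i) = \sum_(i < m) complex.Re (f i).
Proof.
elim: m f => [|m IH] f; rewrite ?big_ord0 // !big_ord_recr /= -IH.
by case: (\sum_(i < m) _) => a b; case: (f _).
Qed.

Lemma cmx_unitary m (U : Mat) : unitary m U <-> (cmx m U)^t* *m cmx m U = 1%:M.
Proof.
have E (i j : 'I_m) : ((cmx m U)^t* *m cmx m U) i j
    = cpx (sumC m (fun k => Cmul (Cconj (U k i)) (U k j))).
  by rewrite cpx_sum !mxE; apply: eq_bigr => k _; rewrite !mxE.
have F (i j : nat) : cpx (if Nat.eqb i j then Defs.C1 else Defs.C0) = (i == j)%:R.
  have -> : Nat.eqb i j = (i == j) by [].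
  by case: (_ == _).
split=> [H | /matrixP H i j /ssrnat.ltP hi /ssrnat.ltP hj].
  apply/matrixP=> i j; rewrite E H ?F ?mxE //; exact/ssrnat.ltP.
by apply: cpx_inj; have := H (Ordinal hi) (Ordinal hj); rewrite E F mxE.
Qed.

Definition spectrum (m : nat) (lam : nat -> R) : 'rV[R[i]]_m :=
  \row_k Complex (lam k) 0.

Lemma cmx_spectral_decomp m A U lam : spectral_decomp m A U lam <->
  (cmx m U)^t* *m cmx m U = 1%:M /\
  cmx m A = cmx m U *m diag_mx (spectrum m lam) *m (cmx m U)^t*.
Proof.
have E (i j : 'I_m) :
  (cmx m U *m diag_mx (spectrum m lam) *m (cmx m U)^t*) i j =
  cpx (sumC m (fun k => Cmul (U i k) (Cmul (RtoC (lam k)) (Cconj (U j k))))).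
  rewrite cpx_sum mxE; apply: eq_bigr => k _.
  by rewrite mul_mx_diag !mxE -mulrA.
split=> [[/cmx_unitary HU HA] | [/cmx_unitary HU HA]]; split=> //.
  apply/matrixP=> i j; rewrite E -HA ?mxE //; exact/ssrnat.ltP.
move=> i j /ssrnat.ltP hi /ssrnat.ltP hj; apply: cpx_inj.
by have /matrixP/(_ (Ordinal hi) (Ordinal hj)) := HA; rewrite E mxE.
Qed.

(** A Hermitian matrix is normal, so it factors as [P^t* D P] with [P] unitary; the eigenvectors are
    the columns of [P^t*], and hermiticity makes the diagonal of [D] real. *)
Lemma spectral_theorem m A : Defs.hermitian m A -> exists U lam, spectral_decomp m A U lam.
Proof.
move=> HA.
have herm : cmx m A \is hermsymmx.
  rewrite is_hermitianmxE expr0 scale1r; apply/eqP/matrixP=> i j; rewrite !mxE.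
  rewrite HA ?cpx_conj //; exact/ssrnat.ltP.
have /orthomx_spectralP := hermitian_normalmx herm.
have /mxOverP := hermitian_spectral_diag_real herm.
have := spectral_unitarymx (cmx m A).
move: (spectralmx _) (spectral_diag _) => P d Pu dreal.
rewrite invmx_unitary // => defA.
pose back (x : R[i]) : Cplx := mkC (complex.Re x) (complex.Im x).
have backK x : cpx (back x) = x by case: x.
(* A family indexed by ['I_m] becomes a function on [nat] with value 0 out of range. *)
pose ext (f : 'I_m -> R[i]) (k : nat) : Cplx :=
  if insub k is Some i then back (f i) else Defs.C0.
have extE f (i : 'I_m) : ext f i = back (f i) by rewrite /ext valK.
pose U : Mat := fun i j => ext (fun i1 => cpx (ext (fun j1 => (P^t*) i1 j1) j)) i.
have UE : cmx m U = P^t*.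
  by apply/matrixP=> i j; rewrite mxE /U extE backK extE backK.
exists U, (fun k => Defs.re (ext (fun i => d 0 i) k)).
apply/cmx_spectral_decomp; rewrite UE trmxCK; split; first exact/unitarymxP.
rewrite defA; congr (_ *m diag_mx _ *m _); apply/rowP=> k.
rewrite mxE extE /=.
(* Being fixed by conjugation, the eigenvalue has imaginary part [b] with [- b = b], hence
   [b = 0]. *)
have /CrealP := dreal 0 k; case: (d 0 k) => a b [] /= eb; congr Complex.
by move: eb => /eqP; rewrite eqNr => /eqP.
Qed.

Lemma cmx_qform m A (U : Mat) (k : 'I_m) :
  cpx (qform m A (fun i => U i k)) = ((cmx m U)^t* *m cmx m A *m cmx m U) k k.
Proof.
rewrite /qform cpx_sum -mulmxA mxE; apply: eq_bigr => i _.
rewrite cpx_sum !mxE big_distrr; apply: eq_bigr => j _.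
by rewrite !mxE.
Qed.

(** Put [W = U^t* V]. Then [<u_k, A u_k>] is the sum over [j] of [|W_kj|^2 beta_j], and since [W] is
    unitary the weights [|W_kj|^2] form a doubly stochastic matrix. *)
Lemma unitary_qform_weights m A V beta U : spectral_decomp m A V beta -> unitary m U ->
  exists P : nat -> nat -> R,
    [/\ forall k j, Rle (IZR 0) (P k j),
        forall k, (k < m)%coq_nat -> sumR m (P k) = IZR 1,
        forall j, (j < m)%coq_nat -> sumR m (fun k => P k j) = IZR 1 &
        forall k, (k < m)%coq_nat ->
          Defs.re (qform m A (fun i => U i k)) = sumR m (fun j => Rmult (P k j) (beta j))].
Proof.
move=> /cmx_spectral_decomp[Vu defA] /cmx_unitary Uu.
pose W := (cmx m U)^t* *m cmx m V.
have WtE : W^t* = (cmx m V)^t* *m cmx m U.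
  by rewrite /W trmx_mul map_mxM trmxCK.
have W1 : W *m W^t* = 1%:M.
  by rewrite WtE /W mulmxA -(mulmxA _ (cmx m V)) (mulmx1C Vu) mulmx1.
have W2 : W^t* *m W = 1%:M by exact: mulmx1C.
have WE : (cmx m U)^t* *m cmx m V = W by [].
clearbody W.
pose nsq (z : R[i]) : R := complex.Re z * complex.Re z + complex.Im z * complex.Im z.
have nsqE z : z * conjC z = Complex (nsq z) 0.
  by case: z => a b; congr Complex; rewrite /nsq /= mulrN ?opprK // mulrC addNr.
(* The value 0 out of range keeps the weights nonnegative for all indices. *)
pose P (k j : nat) : R :=
  if insub k is Some k' then if insub j is Some j' then nsq (W k' j') else 0 else 0.
have PE (k j : 'I_m) : P k j = nsq (W k j) by rewrite /P !valK.
exists P; split.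
- move=> k j; rewrite /P; case: insub => [k'|]; last exact/RleP.
  case: insub => [j'|]; last exact/RleP.
  by apply/RleP; rewrite /nsq addr_ge0 // -expr2 sqr_ge0.
- move=> k /ssrnat.ltP hk; pose k' := Ordinal hk; rewrite sumRE.
  have /matrixP/(_ k' k') := W1; rewrite !mxE eqxx => /(congr1 (@complex.Re _)).
  rewrite Re_sum => H; rewrite -[RHS]H; apply: eq_bigr => j _.
  by rewrite (PE k' j) !mxE nsqE.
- move=> k /ssrnat.ltP hk; pose k' := Ordinal hk; rewrite sumRE.
  have /matrixP/(_ k' k') := W2; rewrite !mxE eqxx => /(congr1 (@complex.Re _)).
  rewrite Re_sum => H; rewrite -[RHS]H; apply: eq_bigr => j _.
  by rewrite (PE j k') !mxE mulrC nsqE.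
- move=> k /ssrnat.ltP hk; pose k' := Ordinal hk.
  rewrite ReE (@cmx_qform m A U k') defA.
  rewrite !mulmxA -(mulmxA _ ((cmx m V)^t*)) -WtE WE.
  rewrite mxE Re_sum sumRE; apply: eq_bigr => j _.
  rewrite mul_mx_diag (PE k' j) !mxE mulrAC nsqE /=.
  by rewrite mul0r subr0.
Qed.

Lemma qform_eigvec m A V beta k : spectral_decomp m A V beta -> (k < m)%coq_nat ->
  Defs.re (qform m A (fun i => V i k)) = beta k.
Proof.
move=> /cmx_spectral_decomp[Vu defA] /ssrnat.ltP hk.
rewrite ReE (@cmx_qform m A V (Ordinal hk)) defA.
rewrite !mulmxA Vu mul1mx -mulmxA Vu mulmx1 !mxE eqxx /=.
by [].
Qed.

Lemma sum_eigvals m A V beta : spectral_decomp m A V beta ->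
  sumR m beta = Defs.re (trace m A).
Proof.
move=> /cmx_spectral_decomp[Vu defA].
have : \tr (cmx m A) = \tr (diag_mx (spectrum m beta)).
  by rewrite defA mxtrace_mulC mulmxA Vu mul1mx.
rewrite mxtrace_diag => /(congr1 (@complex.Re _)).
rewrite !Re_sum sumRE ReE /trace cpx_sum Re_sum => H.
transitivity (\sum_i complex.Re (spectrum m beta 0 i)).
  by apply: eq_bigr => i _; rewrite mxE.
by rewrite -H; apply: eq_bigr => i _; rewrite mxE.
Qed.

(** Both sides are the trace of [A A^t*]: the left one computed in an eigenbasis, where the diagonal
    matrix is real and so its own adjoint, the right one entry by entry. *)
Lemma sum_eigvals_sq m A V beta : spectral_decomp m A V beta ->
  sumR m (fun k => Rmult (beta k) (beta k)) =
  sumR m (fun i => sumR m (fun j =>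
    Rplus (Rmult (Defs.re (A i j)) (Defs.re (A i j)))
          (Rmult (Defs.im (A i j)) (Defs.im (A i j))))).
Proof.
move=> /cmx_spectral_decomp[Vu defA].
pose D := diag_mx (spectrum m beta).
have Dt : D^t* = D.
  apply/matrixP=> i j; rewrite !mxE eq_sym; case: eqP => [->|_].
    by rewrite !mulr1n; apply/eqP; rewrite eq_complex /= oppr0 !eqxx.
  by rewrite !mulr0n conjC0.
have At : (cmx m A)^t* = cmx m V *m D *m (cmx m V)^t*.
  by rewrite defA !trmx_mul !map_mxM trmxCK Dt mulmxA.
have : \tr (cmx m A *m (cmx m A)^t*) = \tr (D *m D).
  rewrite At {1}defA -!mulmxA mxtrace_mulC !mulmxA -(mulmxA _ _ (cmx m V)) Vu mulmx1.
  by rewrite -(mulmxA _ _ (cmx m V)) Vu mulmx1.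
move=> /(congr1 (@complex.Re _)); rewrite !Re_sum !sumRE => H.
transitivity (\sum_i complex.Re ((D *m D) i i)).
  apply: eq_bigr => i _; rewrite /D mulmx_diag !mxE eqxx mulr1n /=.
  by rewrite mulr0 subr0.
rewrite -H; apply: eq_bigr => i _.
rewrite mxE Re_sum sumRE; apply: eq_bigr => j _.
rewrite !mxE /=.
by rewrite mulrN opprK.
Qed.

End ComplexMatrices.

(** * Finite sums *)

Lemma sumR_ext k f g : (forall x, (x < k)%nat -> f x = g x) -> sumR k f = sumR k g.
Proof.
  induction k as [|k IH]; simpl; intros H; [reflexivity|].
  rewrite IH, (H k) by auto with arith. reflexivity.
Qed.

Lemma sumR_plus k f g : sumR k (fun x => f x + g x) = sumR k f + sumR k g.
Proof. induction k as [|k IH]; simpl; [|rewrite IH]; ring. Qed.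

Lemma sumR_scal k c f : sumR k (fun x => c * f x) = c * sumR k f.
Proof. induction k as [|k IH]; simpl; [|rewrite IH]; ring. Qed.

Lemma sumR_le k f g : (forall x, (x < k)%nat -> f x <= g x) -> sumR k f <= sumR k g.
Proof.
  induction k as [|k IH]; simpl; intros H; [lra|].
  apply Rplus_le_compat; auto with arith.
Qed.

Lemma sumR_const k c : sumR k (fun _ => c) = INR k * c.
Proof.
  induction k as [|k IH]; [simpl; ring|].
  rewrite S_INR. simpl sumR. rewrite IH. ring.
Qed.

Lemma sumR_nonneg k f : (forall x, (x < k)%nat -> 0 <= f x) -> 0 <= sumR k f.
Proof.
  intros H. replace 0 with (sumR k (fun _ => 0)) by (rewrite sumR_const; ring).
  now apply sumR_le.
Qed.

Lemma sumR_term_le k f x :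
  (forall y, (y < k)%nat -> 0 <= f y) -> (x < k)%nat -> f x <= sumR k f.
Proof.
  induction k as [|k IH]; simpl; intros H Hx; [lia|].
  pose proof (sumR_nonneg k f) as Hs. pose proof (H k) as Hk.
  destruct (Nat.eq_dec x k) as [->|Hne].
  - enough (0 <= sumR k f) by lra. apply Hs. auto with arith.
  - enough (f x <= sumR k f /\ 0 <= f k) by lra.
    split; [apply IH; auto with arith; lia | apply Hk; lia].
Qed.

Lemma sumR_swap k l f :
  sumR k (fun x => sumR l (fun y => f x y)) = sumR l (fun y => sumR k (fun x => f x y)).
Proof.
  induction k as [|k IH]; simpl.
  - rewrite sumR_const. ring.
  - rewrite IH, <- sumR_plus. reflexivity.
Qed.

Lemma re_sumC k f : re (sumC k f) = sumR k (fun x => re (f x)).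
Proof. induction k as [|k IH]; simpl; [|rewrite IH]; reflexivity. Qed.

Lemma im_sumC k f : im (sumC k f) = sumR k (fun x => im (f x)).
Proof. induction k as [|k IH]; simpl; [|rewrite IH]; reflexivity. Qed.

Lemma Cplx_eq a b : re a = re b -> im a = im b -> a = b.
Proof. destruct a, b; simpl; intros -> ->; reflexivity. Qed.

(** * The function [eta]: strong convexity, Jensen's inequality, affine minorants *)

Lemma ln_le_sub_1 z : 0 < z -> ln z <= z - 1.
Proof.
  intros Hz. pose proof (exp_ineq1_le (ln z)) as H. rewrite exp_ln in H; lra.
Qed.

Lemma eta_pos x : 0 < x -> eta x = x * ln x.
Proof. intros H. unfold eta. destruct (Rle_dec x 0); [lra|reflexivity]. Qed.

Lemma eta_0 : eta 0 = 0.
Proof. unfold eta. destruct (Rle_dec 0 0); [reflexivity|lra]. Qed.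

Lemma eta_tangent x y : 0 <= x <= 1 -> 0 < y <= 1 ->
  eta y + (ln y + 1) * (x - y) + (x - y) * (x - y) / 4 <= eta x.
Proof.
  intros Hx Hy. rewrite (eta_pos y) by lra.
  destruct (Req_dec x 0) as [->|Hx0].
  { rewrite eta_0. assert (0 <= y * (1 - y / 4)) by (apply Rmult_le_pos; lra). lra. }
  rewrite (eta_pos x) by lra.
  (* With [a] and [b] the square roots of [x] and [y], [ln (b / a) <= b / a - 1]
     bounds the divergence of [x] from [y] below by [(a - b)^2]. *)
  set (a := sqrt x). set (b := sqrt y).
  assert (Ha : 0 < a) by (apply sqrt_lt_R0; lra).
  assert (Hb : 0 < b) by (apply sqrt_lt_R0; lra).
  assert (Hxa : x = a * a) by (symmetry; apply sqrt_sqrt; lra).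
  assert (Hyb : y = b * b) by (symmetry; apply sqrt_sqrt; lra).
  clearbody a b. subst x y.
  assert (Ha1 : a <= 1) by nra. assert (Hb1 : b <= 1) by nra.
  rewrite !ln_mult by assumption.
  assert (Hd : a * (ln b - ln a) <= b - a).
  { assert (Hq : 0 < b / a) by (apply Rdiv_lt_0_compat; assumption).
    pose proof (ln_le_sub_1 (b / a) Hq) as H.
    unfold Rdiv in H at 1. rewrite ln_mult, ln_Rinv in H by (auto using Rinv_0_lt_compat).
    apply (Rmult_le_compat_l a) in H; [|lra].
    replace (a * (b / a - 1)) with (b - a) in H by (field; lra). lra. }
  assert (H1 : 2 * a * (a * (ln b - ln a)) <= 2 * a * (b - a)) by (apply Rmult_le_compat_l; lra).
  (* The constant 1/4 arises here: [a + b <= 2], so [(x - y)^2 / 4] is at most [(a - b)^2]. *)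
  assert (H2 : (a * a - b * b) * (a * a - b * b) <= 4 * ((a - b) * (a - b))).
  { replace ((a * a - b * b) * (a * a - b * b))
      with ((a + b) * (a + b) * ((a - b) * (a - b))) by ring.
    apply Rmult_le_compat_r; [apply Rle_0_sqr|].
    replace 4 with (2 * 2) by ring. apply Rmult_le_compat; lra. }
  nra.
Qed.

(** Averaging the supporting line at the mean [y] proves Jensen's inequality. The quadratic gain in
    [eta_tangent] pays for subtracting [kappa x^2] as long as [kappa <= 1 / 4]. *)
Lemma eta_jensen N w x kappa :
  0 <= kappa <= 1 / 4 ->
  (forall j, (j < N)%nat -> 0 <= w j) -> sumR N w = 1 ->
  (forall j, (j < N)%nat -> 0 <= x j <= 1) ->
  let y := sumR N (fun j => w j * x j) in
  eta y - kappa * (y * y) <= sumR N (fun j => w j * (eta (x j) - kappa * (x j * x j))).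
Proof.
  intros Hk Hw Hw1 Hx y.
  assert (Hy0 : 0 <= y) by (apply sumR_nonneg; intros; apply Rmult_le_pos; firstorder).
  assert (Hy1 : y <= 1).
  { rewrite <- Hw1. apply sumR_le. intros j Hj.
    specialize (Hw j Hj). specialize (Hx j Hj). nra. }
  (* At [y = 0] no supporting line of finite slope is available, but then every [w j * x j] is zero
     and the right-hand side vanishes term by term. *)
  destruct (Req_dec y 0) as [Hy|Hy].
  - rewrite Hy, eta_0. rewrite (sumR_ext N _ (fun _ => 0)); [rewrite sumR_const; lra|].
    intros j Hj. assert (Hz : w j * x j <= 0).
    { rewrite <- Hy. apply (sumR_term_le N (fun j => w j * x j)); [|exact Hj].
      intros; apply Rmult_le_pos; firstorder. }
    assert (Hz' : w j * x j = 0).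
    { apply Rle_antisym; [exact Hz|]. apply Rmult_le_pos; [auto|now apply Hx]. }
    destruct (Rmult_integral _ _ Hz') as [-> | ->]; [|rewrite eta_0]; ring.
  (* The line [a + b x] is the tangent at [y] of the function [eta x - kappa x^2]. *)
  - set (b := ln y + 1 - 2 * kappa * y).
    set (a := eta y - (ln y + 1) * y + kappa * (y * y)).
    apply Rle_trans with (sumR N (fun j => a * w j + b * (w j * x j))).
    + rewrite sumR_plus, !sumR_scal, Hw1. fold y. unfold a, b. apply Req_le. ring.
    + apply sumR_le. intros j Hj.
      specialize (Hw j Hj). specialize (Hx j Hj).
      pose proof (eta_tangent (x j) y Hx ltac:(lra)) as Ht.
      replace (a * w j + b * (w j * x j)) with (w j * (a + b * x j)) by ring.
      apply Rmult_le_compat_l; [assumption|]. unfold a, b.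
      assert (0 <= (1 / 4 - kappa) * ((x j - y) * (x j - y)))
        by (apply Rmult_le_pos; [lra | apply Rle_0_sqr]).
      nra.
Qed.

(** For [l > 0] the tangent at [l] is exact. At [l = 0] the slope of [eta] is infinite, which is why
    [eps] appears: the tangent at [y] has intercept [- y], so any [y <= eps] will do. *)
Lemma eta_affine_minorant l eps : 0 <= l <= 1 -> 0 < eps ->
  exists a b, (forall x, 0 <= x <= 1 -> a + b * x <= eta x) /\ eta l - eps <= a + b * l.
Proof.
  intros Hl He.
  assert (Htan : forall y, 0 < y <= 1 -> forall x, 0 <= x <= 1 ->
    eta y - (ln y + 1) * y + (ln y + 1) * x <= eta x).
  { intros y Hy x Hx. pose proof (eta_tangent x y Hx Hy).
    pose proof (Rle_0_sqr (x - y)) as Hsq. unfold Rsqr in Hsq. lra. }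
  destruct (Req_dec l 0) as [->|Hl0].
  - set (y := Rmin eps 1).
    assert (Hy : 0 < y <= 1) by (unfold y; pose proof (Rmin_r eps 1); split;
      [apply Rmin_glb_lt; lra | lra]).
    exists (eta y - (ln y + 1) * y), (ln y + 1). split; [now apply Htan|].
    rewrite eta_0, eta_pos by lra. pose proof (Rmin_l eps 1) as Hm. fold y in Hm. lra.
  - exists (eta l - (ln l + 1) * l), (ln l + 1). split; [apply Htan; lra | lra].
Qed.

Lemma eta_nonpos x : 0 <= x <= 1 -> eta x <= 0.
Proof.
  intros Hx. destruct (Req_dec x 0) as [->|H0]; [rewrite eta_0; lra|].
  rewrite eta_pos by lra. pose proof (ln_le_sub_1 x ltac:(lra)). nra.
Qed.

Lemma eta_ge_m1 x : 0 <= x <= 1 -> -1 <= eta x.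
Proof.
  intros Hx. pose proof (eta_tangent x 1 Hx ltac:(lra)) as H.
  rewrite eta_pos, ln_1 in H by lra. nra.
Qed.

(** * Eigenvalues and entropy of density matrices *)

Definition frob_sq (m : nat) (A : Mat) : R :=
  sumR m (fun i => sumR m (fun j => re (A i j) * re (A i j) + im (A i j) * im (A i j))).

(** The number [d_k(A)], that is the [k]-th diagonal entry of [U^t* A U]; the basis vectors are the
    columns of [U]. *)
Definition diag_in (m : nat) (U A : Mat) (k : nat) : R :=
  re (qform m A (fun i => U i k)).

(** The spectral theorem makes the choice in [eigvals] a genuine one; later facts about the chosen
    eigenvalues all rest on this decomposition. *)
Lemma eigvals_spec m A : hermitian m A -> exists U, spectral_decomp m A U (eigvals m A).
Proof.
  intros HA. unfold eigvals. apply epsilon_spec.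
  destruct (ComplexMatrices.spectral_theorem m A HA) as (U & lam & H).
  exists lam, U. exact H.
Qed.

(** An eigenvalue is the quadratic form at its eigenvector, hence nonnegative; the eigenvalues add
    up to the trace 1, so none exceeds 1. *)
Lemma eigvals_range m A : density m A ->
  forall k, (k < m)%nat -> 0 <= eigvals m A k <= 1.
Proof.
  intros [[HA Hpos] Htr] k Hk.
  destruct (eigvals_spec m A HA) as [U HU].
  assert (Hnn : forall j, (j < m)%nat -> 0 <= eigvals m A j).
  { intros j Hj. rewrite <- (ComplexMatrices.qform_eigvec m A U _ j HU Hj). apply Hpos. }
  split; [now apply Hnn|].
  replace 1 with (sumR m (eigvals m A)).
  - now apply sumR_term_le.
  - rewrite (ComplexMatrices.sum_eigvals m A U _ HU), Htr. reflexivity.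
Qed.

(** Row sums 1 allow Jensen's inequality for each [d_k(A)]; after exchanging the sums, column sums 1
    remove the weights. The case [kappa = 0] bounds the entropy, [kappa = 1 / 4] yields strong
    concavity. *)
Lemma peierls m A U kappa : density m A -> unitary m U -> 0 <= kappa <= 1 / 4 ->
  sumR m (fun k => eta (diag_in m U A k) - kappa * (diag_in m U A k * diag_in m U A k)) <=
  sumR m (fun k => eta (eigvals m A k) - kappa * (eigvals m A k * eigvals m A k)).
Proof.
  intros HA HU Hk. pose proof (eigvals_range m A HA) as Hr.
  destruct HA as [[HA _] _]. destruct (eigvals_spec m A HA) as [V HV].
  destruct (ComplexMatrices.unitary_qform_weights m A V _ U HV HU) as [P [HP Hrow Hcol Hq]].
  set (x := eigvals m A) in *.
  apply Rle_trans with (sumR m (fun k => sumR m (fun j =>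
    P k j * (eta (x j) - kappa * (x j * x j))))).
  - apply sumR_le. intros k Hkm. unfold diag_in. rewrite Hq by assumption.
    apply eta_jensen; auto.
  - rewrite sumR_swap. apply Req_le, sumR_ext. intros j Hj.
    rewrite (sumR_ext m _ (fun k => (eta (x j) - kappa * (x j * x j)) * P k j))
      by (intros; ring).
    rewrite sumR_scal, Hcol by assumption. ring.
Qed.

Lemma entropy_le_diag m A U : density m A -> unitary m U ->
  vN_entropy m A <= - sumR m (fun k => eta (diag_in m U A k)).
Proof.
  intros HA HU. pose proof (peierls m A U 0 HA HU ltac:(lra)) as H.
  unfold vN_entropy. apply Ropp_le_contravar.
  rewrite (sumR_ext m (fun k => eta (diag_in m U A k))
    (fun k => eta (diag_in m U A k) - 0 * (diag_in m U A k * diag_in m U A k)))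
    by (intros; ring).
  rewrite (sumR_ext m (fun k => eta (eigvals m A k))
    (fun k => eta (eigvals m A k) - 0 * (eigvals m A k * eigvals m A k)))
    by (intros; ring).
  exact H.
Qed.

Lemma diag_in_eigenbasis m A V beta k : spectral_decomp m A V beta -> (k < m)%nat ->
  diag_in m V A k = beta k.
Proof. intros HV Hk. exact (ComplexMatrices.qform_eigvec m A V beta k HV Hk). Qed.

(** The crude upper bound, from [eta >= -1], suffices to make the supremum of the objective
    finite. *)
Lemma entropy_bounds m A : density m A -> 0 <= vN_entropy m A <= INR m.
Proof.
  intros HA. pose proof (eigvals_range m A HA) as Hr. unfold vN_entropy.
  assert (H1 : sumR m (fun k => eta (eigvals m A k)) <= INR m * 0).
  { rewrite <- sumR_const. apply sumR_le. intros; now apply eta_nonpos, Hr. }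
  assert (H2 : INR m * (-1) <= sumR m (fun k => eta (eigvals m A k))).
  { rewrite <- sumR_const. apply sumR_le. intros; now apply eta_ge_m1, Hr. }
  lra.
Qed.

Lemma diag_in_range m A U k : density m A -> unitary m U -> (k < m)%nat ->
  0 <= diag_in m U A k <= 1.
Proof.
  intros HA HU Hk. pose proof (eigvals_range m A HA) as Hr.
  destruct HA as [[HA Hpos] _]. split; [apply Hpos|].
  destruct (eigvals_spec m A HA) as [V HV].
  destruct (ComplexMatrices.unitary_qform_weights m A V _ U HV HU) as [P [HP Hrow _ Hq]].
  unfold diag_in. rewrite Hq by assumption. rewrite <- (Hrow k Hk).
  apply sumR_le. intros j Hj. specialize (HP k j). specialize (Hr j Hj). nra.
Qed.

(** * Mixtures, the Frobenius norm and strong concavity of the entropy *)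

Lemma re_mixture n rho p i j : re (mixture n rho p i j) = sumR n (fun x => p x * re (rho x i j)).
Proof. unfold mixture. rewrite re_sumC. apply sumR_ext. intros; simpl; ring. Qed.

Lemma im_mixture n rho p i j : im (mixture n rho p i j) = sumR n (fun x => p x * im (rho x i j)).
Proof. unfold mixture. rewrite im_sumC. apply sumR_ext. intros; simpl; ring. Qed.

(** Written this way the form is visibly real-linear in the entries of [A], so it is linear in the
    weights of a mixture. *)
Lemma re_qform m A v : re (qform m A v) = sumR m (fun i => sumR m (fun j =>
  (re (v i) * re (v j) + im (v i) * im (v j)) * re (A i j) +
  (im (v i) * re (v j) - re (v i) * im (v j)) * im (A i j))).
Proof.
  unfold qform. rewrite re_sumC. apply sumR_ext. intros i _.
  rewrite re_sumC. apply sumR_ext. intros j _. simpl. ring.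
Qed.

Lemma re_qform_mixture m n rho p v :
  re (qform m (mixture n rho p) v) = sumR n (fun x => p x * re (qform m (rho x) v)).
Proof.
  rewrite re_qform.
  rewrite (sumR_ext n _ (fun x => sumR m (fun i => sumR m (fun j => p x * (
    (re (v i) * re (v j) + im (v i) * im (v j)) * re (rho x i j) +
    (im (v i) * re (v j) - re (v i) * im (v j)) * im (rho x i j)))))).
  - rewrite (sumR_swap n m). apply sumR_ext. intros i _.
    rewrite (sumR_swap n m). apply sumR_ext. intros j _.
    rewrite re_mixture, im_mixture, <- !sumR_scal, <- sumR_plus.
    apply sumR_ext. intros. ring.
  - intros x _. rewrite re_qform, <- sumR_scal. apply sumR_ext. intros i _.
    rewrite <- sumR_scal. reflexivity.
Qed.

Lemma density_mixture m n rho p : (forall x, (x < n)%nat -> density m (rho x)) ->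
  in_simplex n p -> density m (mixture n rho p).
Proof.
  intros Hrho [Hp Hp1]. split; [split|].
  - intros i j Hi Hj. apply Cplx_eq; simpl.
    + rewrite !re_mixture. apply sumR_ext. intros x Hx.
      destruct (Hrho x Hx) as [[H _] _]. rewrite (H i j Hi Hj). reflexivity.
    + rewrite !im_mixture, (sumR_ext n _ (fun x => (-1) * (p x * im (rho x j i)))).
      * rewrite sumR_scal. ring.
      * intros x Hx. destruct (Hrho x Hx) as [[H _] _]. rewrite (H i j Hi Hj). simpl. ring.
  - intros v. rewrite re_qform_mixture. apply sumR_nonneg. intros x Hx.
    apply Rmult_le_pos; [now apply Hp | apply (Hrho x Hx)].
  - assert (Ht : forall x, (x < n)%nat ->
      sumR m (fun i => re (rho x i i)) = 1 /\ sumR m (fun i => im (rho x i i)) = 0).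
    { intros x Hx. destruct (Hrho x Hx) as [_ H]. unfold trace in H.
      rewrite <- re_sumC, <- im_sumC, H. split; reflexivity. }
    unfold trace. apply Cplx_eq; simpl.
    + rewrite re_sumC, (sumR_ext m _ (fun i => sumR n (fun x => p x * re (rho x i i))))
        by (intros; apply re_mixture).
      rewrite sumR_swap, <- Hp1. apply sumR_ext. intros x Hx.
      rewrite sumR_scal. destruct (Ht x Hx) as [-> _]. ring.
    + rewrite im_sumC, (sumR_ext m _ (fun i => sumR n (fun x => p x * im (rho x i i))))
        by (intros; apply im_mixture).
      rewrite sumR_swap, (sumR_ext n _ (fun _ => 0)); [rewrite sumR_const; ring|].
      intros x Hx. rewrite sumR_scal. destruct (Ht x Hx) as [_ ->]. ring.
Qed.

Lemma in_simplex_convex n p q t : in_simplex n p -> in_simplex n q -> 0 <= t <= 1 ->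
  in_simplex n (fun x => t * p x + (1 - t) * q x).
Proof.
  intros [Hp Hp1] [Hq Hq1] Ht. split.
  - intros x Hx. specialize (Hp x Hx). specialize (Hq x Hx).
    apply Rplus_le_le_0_compat; apply Rmult_le_pos; lra.
  - rewrite sumR_plus, !sumR_scal, Hp1, Hq1. ring.
Qed.

Lemma sumR_convex n p q t f :
  sumR n (fun x => (t * p x + (1 - t) * q x) * f x) =
  t * sumR n (fun x => p x * f x) + (1 - t) * sumR n (fun x => q x * f x).
Proof. rewrite <- !sumR_scal, <- sumR_plus. apply sumR_ext. intros. ring. Qed.

Lemma sumR_diff n p q f :
  sumR n (fun x => (p x - q x) * f x) = sumR n (fun x => p x * f x) - sumR n (fun x => q x * f x).
Proof.
  replace (sumR n (fun x => p x * f x)) with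
    (sumR n (fun x => (p x - q x) * f x) + sumR n (fun x => q x * f x)); [ring|].
  rewrite <- sumR_plus. apply sumR_ext. intros. ring.
Qed.

(** The identity [(t b + (1 - t) c)^2 + t (1 - t) (b - c)^2 = t b^2 + (1 - t) c^2], summed over the
    real and imaginary parts of all entries. *)
Lemma frob_sq_convex m n rho p q t :
  frob_sq m (mixture n rho (fun x => t * p x + (1 - t) * q x))
  + t * (1 - t) * frob_sq m (mixture n rho (fun x => p x - q x)) =
  t * frob_sq m (mixture n rho p) + (1 - t) * frob_sq m (mixture n rho q).
Proof.
  unfold frob_sq.
  rewrite <- !sumR_scal, <- !sumR_plus. apply sumR_ext. intros i _.
  rewrite <- !sumR_scal, <- !sumR_plus. apply sumR_ext. intros j _.
  rewrite !re_mixture, !im_mixture, !sumR_convex, !sumR_diff. ring.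
Qed.

Lemma frob_sq_pos m A i j : (i < m)%nat -> (j < m)%nat -> A i j <> C0 -> 0 < frob_sq m A.
Proof.
  intros Hi Hj HA.
  assert (Hnn : forall k l, 0 <= re (A k l) * re (A k l) + im (A k l) * im (A k l))
    by (intros; nra).
  apply Rlt_le_trans with (re (A i j) * re (A i j) + im (A i j) * im (A i j)).
  - destruct (Hnn i j) as [H|H]; [exact H|]. exfalso. apply HA.
    apply Cplx_eq; simpl; nra.
  - apply Rle_trans with (sumR m (fun l => re (A i l) * re (A i l) + im (A i l) * im (A i l))).
    + apply (sumR_term_le m (fun l => re (A i l) * re (A i l) + im (A i l) * im (A i l))); auto.
    + apply (sumR_term_le m (fun k => sumR m (fun l =>
        re (A k l) * re (A k l) + im (A k l) * im (A k l)))); [|assumption].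
      intros; apply sumR_nonneg; auto.
Qed.

Lemma entropy_strongly_concave m n rho p q t :
  (forall x, (x < n)%nat -> density m (rho x)) ->
  in_simplex n p -> in_simplex n q -> 0 <= t <= 1 ->
  t * vN_entropy m (mixture n rho p) + (1 - t) * vN_entropy m (mixture n rho q)
  + t * (1 - t) / 4 * frob_sq m (mixture n rho (fun x => p x - q x))
  <= vN_entropy m (mixture n rho (fun x => t * p x + (1 - t) * q x)).
Proof.
  intros Hrho Hp Hq Ht.
  set (B := mixture n rho p). set (C := mixture n rho q).
  set (A := mixture n rho (fun x => t * p x + (1 - t) * q x)).
  assert (HB : density m B) by now apply density_mixture.
  assert (HC : density m C) by now apply density_mixture.
  assert (HA : density m A) by (apply density_mixture; [assumption|now apply in_simplex_convex]).
  (* The quadratic part of the spectral sum is a Frobenius norm, hence an explicit function of the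
     entries. *)
  assert (Hsum : forall M, density m M ->
    sumR m (fun k => eta (eigvals m M k) - 1 / 4 * (eigvals m M k * eigvals m M k)) =
    - vN_entropy m M - 1 / 4 * frob_sq m M).
  { intros M [[HM _] _]. destruct (eigvals_spec m M HM) as [W HW].
    pose proof (ComplexMatrices.sum_eigvals_sq m M W _ HW) as Hsq.
    change (sumR m (fun k => eigvals m M k * eigvals m M k) = frob_sq m M) in Hsq.
    rewrite <- Hsq. unfold vN_entropy.
    rewrite (sumR_ext m _ (fun k => eta (eigvals m M k)
      + (- (1 / 4)) * (eigvals m M k * eigvals m M k))) by (intros; ring).
    rewrite sumR_plus, sumR_scal. ring. }
  destruct HA as [[HAh HAp] HAt]. destruct (eigvals_spec m A HAh) as [U HU].
  assert (HAd : density m A) by (split; [split|]; assumption).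
  assert (HUu : unitary m U) by apply HU.
  pose proof (peierls m B U (1 / 4) HB HUu ltac:(lra)) as PB.
  pose proof (peierls m C U (1 / 4) HC HUu ltac:(lra)) as PC.
  rewrite Hsum in PB, PC by assumption.
  (* In the eigenbasis [U] of [A] each eigenvalue of [A] is the combination of [d_k(B)] and [d_k(C)]
     with weights [t] and [1 - t], so two-point Jensen applies for every [k]. *)
  assert (HJ : sumR m (fun k => eta (eigvals m A k) - 1 / 4 * (eigvals m A k * eigvals m A k)) <=
    t * sumR m (fun k => eta (diag_in m U B k) - 1 / 4 * (diag_in m U B k * diag_in m U B k)) +
    (1 - t) * sumR m (fun k => eta (diag_in m U C k) - 1 / 4 * (diag_in m U C k * diag_in m U C k))).
  { rewrite <- !sumR_scal, <- sumR_plus. apply sumR_le. intros k Hk.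
    pose proof (diag_in_range m B U k HB HUu Hk) as Hb.
    pose proof (diag_in_range m C U k HC HUu Hk) as Hc.
    rewrite <- (diag_in_eigenbasis m A U _ k HU Hk).
    replace (diag_in m U A k) with (t * diag_in m U B k + (1 - t) * diag_in m U C k)
      by (unfold diag_in, A, B, C; rewrite !re_qform_mixture, sumR_convex; reflexivity).
    pose proof (eta_jensen 2 (fun i => match i with O => t | _ => 1 - t end)
      (fun i => match i with O => diag_in m U B k | _ => diag_in m U C k end) (1 / 4)
      ltac:(lra)) as J.
    simpl in J. rewrite !Rplus_0_l in J. apply J; [ | ring | ];
      intros [|j] _; simpl; lra. }
  rewrite Hsum in HJ by assumption.
  apply (Rmult_le_compat_l t) in PB; [|lra].
  apply (Rmult_le_compat_l (1 - t)) in PC; [|lra].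
  (* The remaining Frobenius terms, [t |B|^2 + (1 - t) |C|^2 - |A|^2], equal
     [t (1 - t) |B - C|^2]. *)
  pose proof (frob_sq_convex m n rho p q t) as HF. fold A B C in HF.
  lra.
Qed.

(** * Compactness of the simplex and attained maxima *)

Lemma Un_cv_subseq u l phi : (forall j, (j <= phi j)%nat) -> Un_cv u l ->
  Un_cv (fun j => u (phi j)) l.
Proof.
  intros Hphi Hu eps He. destruct (Hu eps He) as [N HN]. exists N.
  intros j Hj. apply HN. specialize (Hphi j). lia.
Qed.

Lemma Un_cv_const c : Un_cv (fun _ => c) c.
Proof. intros eps He. exists O. intros. rewrite Rdist_eq. exact He. Qed.

Lemma Un_cv_sumR n u l : (forall x, (x < n)%nat -> Un_cv (fun j => u j x) (l x)) ->
  Un_cv (fun j => sumR n (u j)) (sumR n l).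
Proof.
  induction n as [|n IH]; simpl; intros H; [apply Un_cv_const|].
  apply (CV_plus (fun j => sumR n (u j)) (fun j => u j n)); auto.
Qed.

Lemma Un_cv_inv_S : Un_cv (fun j => / INR (S j)) 0.
Proof.
  intros eps He. destruct (archimed_cor1 eps He) as (N & HN & HN0). exists N.
  intros j Hj. unfold Rdist. rewrite Rminus_0_r, Rabs_right.
  - apply Rle_lt_trans with (/ INR N); [|exact HN].
    apply Rinv_le_contravar; [now apply lt_0_INR | apply le_INR; lia].
  - apply Rle_ge, Rlt_le, Rinv_0_lt_compat, lt_0_INR. lia.
Qed.

(** Bolzano-Weierstrass gives a cluster point [l]; for each [j] an index [p >= j] is chosen with
    [u p] within [1 / (j + 1)] of [l]. The selection [phi] may fail to be monotone, but [j <= phi j]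
    is enough to preserve limits. *)
Lemma bounded_subseq u : (forall j, 0 <= u j <= 1) ->
  exists phi l, (forall j, (j <= phi j)%nat) /\ Un_cv (fun j => u (phi j)) l.
Proof.
  intros Hu.
  destruct (Bolzano_Weierstrass u (fun x => 0 <= x <= 1) (compact_P3 0 1) Hu) as [l Hl].
  assert (Hp : forall j, {p | (j <= p)%nat /\ Rabs (u p - l) < / INR (S j)}).
  { intros j. apply constructive_indefinite_description.
    assert (Hd : 0 < / INR (S j)) by (apply Rinv_0_lt_compat, lt_0_INR; lia).
    apply (Hl (disc l (mkposreal _ Hd))).
    exists (mkposreal _ Hd). intros x Hx. exact Hx. }
  exists (fun j => proj1_sig (Hp j)), l. split.
  - intros j. apply (proj2_sig (Hp j)).
  - intros eps He. destruct (Un_cv_inv_S eps He) as [N HN]. exists N.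
    intros j Hj. specialize (HN j Hj). destruct (proj2_sig (Hp j)) as [_ H].
    unfold Rdist in *. rewrite Rminus_0_r in HN.
    apply Rlt_trans with (1 := H). apply Rle_lt_trans with (2 := HN). apply Rle_abs.
Qed.

(** One coordinate is added at a time: composing with a further selection [psi] makes the new
    coordinate converge and keeps the limits already found. *)
Lemma bounded_vector_subseq n (u : nat -> nat -> R) :
  (forall j x, (x < n)%nat -> 0 <= u j x <= 1) ->
  exists phi l, (forall j, (j <= phi j)%nat) /\
    forall x, (x < n)%nat -> Un_cv (fun j => u (phi j) x) (l x).
Proof.
  induction n as [|n IH]; intros Hu.
  - exists (fun j => j), (fun _ => 0). split; [auto|]. intros x Hx. lia.
  - destruct IH as (phi & l & Hphi & Hl); [intros; apply Hu; lia|].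
    destruct (bounded_subseq (fun j => u (phi j) n)) as (psi & r & Hpsi & Hr);
      [intros; apply Hu; lia|].
    exists (fun j => phi (psi j)), (fun x => if Nat.eq_dec x n then r else l x). split.
    + intros j. apply Nat.le_trans with (psi j); auto.
    + intros x Hx. destruct (Nat.eq_dec x n) as [->|Hne]; [exact Hr|].
      apply (Un_cv_subseq (fun j => u (phi j) x)); [exact Hpsi|]. apply Hl. lia.
Qed.

Lemma in_simplex_range n p x : in_simplex n p -> (x < n)%nat -> 0 <= p x <= 1.
Proof.
  intros [Hp Hp1] Hx. split; [auto|]. rewrite <- Hp1. now apply sumR_term_le.
Qed.

(** On the simplex [f] is the pointwise infimum of its affine majorants. This form of upper
    semicontinuity is convenient because affine functions commute with coordinatewise limits. *)
Definition affine_usc_on_simplex (n : nat) (f : (nat -> R) -> R) : Prop :=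
  forall l eps, in_simplex n l -> 0 < eps -> exists a c,
    (forall q, in_simplex n q -> f q <= a + sumR n (fun x => c x * q x)) /\
    a + sumR n (fun x => c x * l x) <= f l + eps.

(** A maximizing sequence has a subsequence converging to some [l] in the simplex; a majorant that
    is nearly tight at [l] bounds the supremum by [f l + eps]. *)
Lemma affine_usc_attains_max n f M : (1 <= n)%nat ->
  (forall q, in_simplex n q -> f q <= M) -> affine_usc_on_simplex n f ->
  exists p, in_simplex n p /\ forall q, in_simplex n q -> f q <= f p.
Proof.
  intros Hn HM Husc.
  destruct (completeness (fun r => exists q, in_simplex n q /\ r = f q)) as [S [HS1 HS2]].
  { exists M. intros r (q & Hq & ->). now apply HM. }
  (* The vertex at index 0 shows that the simplex is nonempty; this is where [1 <= n] enters. *)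
  { exists (f (fun x => if Nat.eq_dec x 0 then 1 else 0)), (fun x => if Nat.eq_dec x 0 then 1 else 0).
    split; [|reflexivity]. split.
    - intros x _. destruct (Nat.eq_dec x 0); lra.
    - clear -Hn. induction n as [|[|n] IH]; [lia | simpl; lra |].
      change (sumR (S n) (fun x => if Nat.eq_dec x 0 then 1 else 0)
        + (if Nat.eq_dec (S n) 0 then 1 else 0) = 1).
      rewrite IH by lia. destruct (Nat.eq_dec (S n) 0); [lia|ring]. }
  (* From here on [S] is the supremum and shadows the successor, written [Datatypes.S]. *)
  assert (Hp : forall j, {p | in_simplex n p /\ S - / INR (Datatypes.S j) <= f p}).
  { intros j. apply constructive_indefinite_description. apply NNPP. intros Hno.
    assert (Hd : 0 < / INR (Datatypes.S j)) by (apply Rinv_0_lt_compat, lt_0_INR; lia).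
    assert (S <= S - / INR (Datatypes.S j)); [|lra].
    apply HS2. intros r (q & Hq & ->). apply Rnot_lt_le. intros Hlt. apply Hno.
    exists q. split; [exact Hq | lra]. }
  set (u := fun j => proj1_sig (Hp j)).
  assert (Hu : forall j, in_simplex n (u j)) by (intros j; apply (proj2_sig (Hp j))).
  assert (Huf : forall j, S - / INR (Datatypes.S j) <= f (u j))
    by (intros j; apply (proj2_sig (Hp j))).
  clearbody u. clear Hp.
  destruct (bounded_vector_subseq n u) as (phi & l & Hphi & Hl);
    [intros; now apply (in_simplex_range n)|].
  assert (Hls : in_simplex n l).
  { split.
    - intros x Hx. apply (@Rle_cv_lim (fun _ => 0) (fun j => u (phi j) x));
        [intros j; now apply (Hu (phi j)) | apply Un_cv_const | now apply Hl].
    - apply (UL_sequence (fun j => sumR n (u (phi j)))).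
      + now apply (Un_cv_sumR n (fun j => u (phi j))).
      + intros eps He. exists O. intros j _. rewrite (proj2 (Hu (phi j))), Rdist_eq. exact He. }
  exists l. split; [exact Hls|]. intros q Hq.
  apply Rle_trans with S; [apply HS1; exists q; auto|].
  apply le_epsilon. intros eps He.
  destruct (Husc l eps Hls He) as (a & c & Hac & Hle).
  apply Rle_trans with (2 := Hle).
  (* The majorant dominates [S - 1 / (phi j + 1)] along the subsequence; both sides pass to the
     limit. *)
  apply (@Rle_cv_lim (fun j => S - / INR (Datatypes.S (phi j)))
    (fun j => a + sumR n (fun x => c x * u (phi j) x))).
  - intros j. apply Rle_trans with (1 := Huf (phi j)). apply Hac, Hu.
  - replace S with (S - 0) at 1 by ring.
    apply CV_minus; [apply Un_cv_const|].
    apply (Un_cv_subseq (fun j => / INR (Datatypes.S j))); [exact Hphi | apply Un_cv_inv_S].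
  - apply CV_plus; [apply Un_cv_const|].
    apply (Un_cv_sumR n (fun j x => c x * u (phi j) x) (fun x => c x * l x)).
    intros x Hx. apply CV_mult; [apply Un_cv_const | now apply Hl].
Qed.

(** * The Holevo objective: semicontinuity, strict concavity, unique maximizer *)

Lemma holevo_affine_usc m n rho s lam : (forall x, (x < n)%nat -> density m (rho x)) ->
  affine_usc_on_simplex n (fun p => holevo m n rho p - lam * dotR n s p).
Proof.
  intros Hrho l eps Hl He.
  pose proof (density_mixture m n rho l Hrho Hl) as HA.
  destruct (eigvals_spec m (mixture n rho l) (proj1 (proj1 HA))) as [U HU].
  assert (HUu : unitary m U) by apply HU.
  (* The basis [U] diagonalizes the mixture at [l] and stays fixed while [q] varies, so the diagonal
     entries are linear in [q]. *)
  set (D := fun k x => diag_in m U (rho x) k).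
  assert (HD : forall q k, diag_in m U (mixture n rho q) k = sumR n (fun x => q x * D k x))
    by (intros; apply re_qform_mixture).
  (* Each of the [m] minorants may lose [e], in total less than [eps]; the added 1 keeps the
     denominator positive when [m = 0]. *)
  set (e := eps / (INR m + 1)).
  assert (Hm : 0 < INR m + 1) by (pose proof (pos_INR m); lra).
  assert (He' : 0 < e) by (apply Rdiv_lt_0_compat; assumption).
  assert (Hab : forall k, {ab : R * R | (k < m)%nat ->
    (forall y, 0 <= y <= 1 -> fst ab + snd ab * y <= eta y) /\
    eta (diag_in m U (mixture n rho l) k) - e
      <= fst ab + snd ab * diag_in m U (mixture n rho l) k}).
  { intros k. apply constructive_indefinite_description.
    destruct (Nat.le_gt_cases m k) as [Hk|Hk]; [exists (0, 0); lia|].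
    destruct (eta_affine_minorant _ e (diag_in_range m _ U k HA HUu Hk) He') as (a & b & H).
    exists (a, b). intros _. exact H. }
  set (a := fun k => fst (proj1_sig (Hab k))). set (b := fun k => snd (proj1_sig (Hab k))).
  assert (Hmin : forall k y, (k < m)%nat -> 0 <= y <= 1 -> a k + b k * y <= eta y)
    by (intros k y Hk; now apply (proj2_sig (Hab k))).
  assert (Hat : forall k, (k < m)%nat -> eta (diag_in m U (mixture n rho l) k) - e
      <= a k + b k * diag_in m U (mixture n rho l) k)
    by (intros k Hk; now apply (proj2_sig (Hab k))).
  clearbody a b. clear Hab.
  (* Replacing each [eta] by its minorant gives an affine majorant of the entropy; the other two
     terms of the objective are already linear in the weights. *)
  exists (- sumR m a), (fun x =>
    - sumR m (fun k => b k * D k x) - vN_entropy m (rho x) - lam * s x).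
  assert (Haff : forall q, - sumR m a + sumR n (fun x =>
      (- sumR m (fun k => b k * D k x) - vN_entropy m (rho x) - lam * s x) * q x) =
    - sumR m (fun k => a k + b k * diag_in m U (mixture n rho q) k)
    - sumR n (fun x => q x * vN_entropy m (rho x)) - lam * dotR n s q).
  { intros q. unfold dotR. rewrite sumR_plus.
    rewrite (sumR_ext m (fun k => b k * diag_in m U (mixture n rho q) k)
      (fun k => sumR n (fun x => q x * (b k * D k x)))).
    2: { intros k _. rewrite HD, <- sumR_scal. apply sumR_ext. intros; ring. }
    rewrite sumR_swap, <- sumR_scal.
    rewrite (sumR_ext n (fun x => sumR m (fun k => q x * (b k * D k x)))
      (fun x => q x * sumR m (fun k => b k * D k x))) by (intros; apply sumR_scal).
    rewrite (sumR_ext n _ (fun x => (-1) * (q x * sumR m (fun k => b k * D k x)) +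
      ((-1) * (q x * vN_entropy m (rho x)) + (-1) * (lam * (s x * q x))))) by (intros; ring).
    rewrite !sumR_plus, !sumR_scal. ring. }
  split.
  - intros q Hq. rewrite Haff. unfold holevo.
    pose proof (density_mixture m n rho q Hrho Hq) as HB.
    pose proof (entropy_le_diag m _ U HB HUu) as H1.
    assert (H2 : sumR m (fun k => a k + b k * diag_in m U (mixture n rho q) k) <=
      sumR m (fun k => eta (diag_in m U (mixture n rho q) k))).
    { apply sumR_le. intros k Hk. apply Hmin; [exact Hk | now apply diag_in_range]. }
    lra.
  (* At [l] itself the diagonal entries are the eigenvalues, so only the loss in the minorants
     remains. *)
  - rewrite Haff. unfold holevo.
    assert (H1 : vN_entropy m (mixture n rho l) =
      - sumR m (fun k => eta (diag_in m U (mixture n rho l) k))).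
    { unfold vN_entropy. f_equal. apply sumR_ext. intros k Hk.
      now rewrite (diag_in_eigenbasis m _ U _ k HU Hk). }
    assert (H2 : sumR m (fun k => eta (diag_in m U (mixture n rho l) k)) + INR m * (- e) <=
      sumR m (fun k => a k + b k * diag_in m U (mixture n rho l) k)).
    { rewrite <- sumR_const, <- sumR_plus. apply sumR_le. intros k Hk.
      specialize (Hat k Hk). lra. }
    assert (H3 : INR m * e + e = eps) by (unfold e; field; lra).
    lra.
Qed.

(** The average of the [vN_entropy m (rho x)] and the cost are linear in the weights, so the
    quadratic gap of [entropy_strongly_concave] survives unchanged. *)
Lemma holevo_strictly_concave m n rho s lam :
  (forall x, (x < n)%nat -> density m (rho x)) -> lin_indep m n rho ->
  strictly_concave_on_simplex n (fun p => holevo m n rho p - lam * dotR n s p).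
Proof.
  intros Hrho Hind p q Hp Hq [x [Hx Hne]] t Ht.
  pose proof (entropy_strongly_concave m n rho p q t Hrho Hp Hq ltac:(lra)) as H.
  assert (Hpos : 0 < frob_sq m (mixture n rho (fun x => p x - q x))).
  (* If the norm were not positive, all entries of the mixture with coefficients [p x - q x] would
     vanish, and independence would force [p x = q x]. *)
  { apply NNPP. intros Hno. apply Hne, Rminus_diag_uniq.
    apply (Hind (fun x => p x - q x)); [|exact Hx].
    intros i j Hi Hj. apply NNPP. intros Hij. apply Hno. now apply (frob_sq_pos m _ i j). }
  assert (Ht2 : 0 < t * (1 - t) / 4) by (apply Rdiv_lt_0_compat; [apply Rmult_lt_0_compat|]; lra).
  pose proof (Rmult_lt_0_compat _ _ Ht2 Hpos) as Hgap.
  unfold holevo, dotR. rewrite sumR_convex.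
  rewrite (sumR_ext n (fun x => s x * (t * p x + (1 - t) * q x))
    (fun x => t * (s x * p x) + (1 - t) * (s x * q x))) by (intros; ring).
  rewrite sumR_plus, !sumR_scal. lra.
Qed.

(** The midpoint of two distinct maximizers would have a strictly larger value. *)
Lemma strictly_concave_maximizer_unique n f p q :
  strictly_concave_on_simplex n f -> in_simplex n p -> in_simplex n q ->
  (forall r, in_simplex n r -> f r <= f p) -> f p <= f q ->
  forall x, (x < n)%nat -> q x = p x.
Proof.
  intros Hf Hp Hq Hmax Hle x Hx. apply NNPP. intros Hne.
  pose proof (Hf p q Hp Hq (ex_intro _ x (conj Hx (not_eq_sym Hne))) (1 / 2) ltac:(lra)) as H.
  pose proof (Hmax _ (in_simplex_convex n p q (1 / 2) Hp Hq ltac:(lra))). lra.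
Qed.

Theorem theorem5 (m n : nat) (rho : nat -> Mat) (s : nat -> R)
  (Hn : (1 <= n)%nat)
  (Hrho : forall x, (x < n)%nat -> density m (rho x))
  (Hs : forall x, (x < n)%nat -> 0 <= s x)
  (Hind : lin_indep m n rho) :
  forall lam : R, 0 <= lam ->
    strictly_concave_on_simplex n (fun p => holevo m n rho p - lam * dotR n s p) /\
    unique_maximizer_on_simplex n (fun p => holevo m n rho p - lam * dotR n s p).
Proof.
  intros lam Hlam.
  pose proof (holevo_strictly_concave m n rho s lam Hrho Hind) as Hconc.
  split; [exact Hconc|].
  destruct (affine_usc_attains_max n (fun p => holevo m n rho p - lam * dotR n s p) (INR m) Hn)
    as (p & Hp & Hmax).
  (* The subtracted terms are nonnegative, the cost because [lam] and [s] are, so the entropy bound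
     [INR m] also bounds the objective. *)
  - intros q Hq. unfold holevo.
    pose proof (entropy_bounds m _ (density_mixture m n rho q Hrho Hq)) as [_ H1].
    assert (H2 : 0 <= sumR n (fun x => q x * vN_entropy m (rho x))).
    { apply sumR_nonneg. intros x Hx.
      apply Rmult_le_pos; [now apply Hq | now apply entropy_bounds, Hrho]. }
    assert (H3 : 0 <= lam * dotR n s q).
    { apply Rmult_le_pos; [exact Hlam|]. apply sumR_nonneg. intros x Hx.
      apply Rmult_le_pos; [now apply Hs | now apply Hq]. }
    lra.
  - now apply holevo_affine_usc.
  - exists p. split; [exact Hp|]. split; [exact Hmax|].
    intros q Hq Hle. now apply (strictly_concave_maximizer_unique n _ p q Hconc Hp Hq Hmax).
Qed.
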